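(* Let $p$ be a prime and let $L$ be a Leibniz ring whose additive group is elementary abelian of order $p^2$. Suppose that $L$ is not a Lie ring. Then $L$ is of one of the following two types: (1) $L=\langle a\rangle\oplus\langle b\rangle$ (direct sum of additive subgroups), where $pa=pb=0$, $[a,a]=b$, $[b,a]=[a,b]=[b,b]=0$; here $Leib(L)=[L,L]=\zeta(L)=\langle b\rangle$; (2) $L=\langle c\rangle\oplus\langle d\rangle$ (direct sum of additive subgroups), where $pc=pd=0$, $[c,c]=[c,d]=d$, $[d,c]=[d,d]=0$; here $Leib(L)=[L,L]=\zeta^{\mathrm{left}}(L)=\langle d\rangle$ and $\zeta^{\mathrm{right}}(L)=\zeta(L)=\langle 0\rangle$.
   Context: A (left) Leibniz ring is a set $L$ with binary operations $+$ and $[,]$ such that $L$ is an abelian group under $+$, the operation $[,]$ is additive in each argument, and $[a,[b,c]]=[[a,b],c]+[b,[a,c]]$ for all $a,b,c\in L$. A Lie ring is an abelian group with a biadditive bracket $[,]$ such that $[a,a]=0$ and $[[a,b],c]+[[b,c],a]+[[c,a],b]=0$ for all $a,b,c$. $\langle x\rangle$ denotes the additive cyclic subgroup generated by $x$. $Leib(L)$ (the Leibniz kernel) is the additive subgroup generated by all elements $[x,x]$, $x\in L$; $[L,L]$ (the derived ideal) is the additive subgroup generated by all $[x,y]$, $x,y\in L$. The left center is $\zeta^{\mathrm{left}}(L)=\{x\in L\mid [x,y]=0 \text{ for all } y\in L\}$, the right center is $\zeta^{\mathrm{right}}(L)=\{x\in L\mid [y,x]=0 \text{ for all } y\in L\}$,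 and the center is $\zeta(L)=\{x\in L\mid [x,y]=[y,x]=0 \text{ for all } y\in L\}$.
   Formalization: In type (2) the claim that the right center is ⟨0⟩ is false, since [c,c−d]=[d,c−d]=0; it is replaced by ζ^right(L)=⟨c−d⟩, while ζ(L)=⟨0⟩ is kept. *)

(* Defs.v *)
From HB Require Import structures.
From mathcomp Require Import all_boot all_order all_algebra.
From mathcomp Require Import all_fingroup all_solvable.

Set Implicit Arguments.
Unset Strict Implicit.
Unset Printing Implicit Defensive.

Import GRing.Theory.
Local Open Scope ring_scope.

Section Brackets.

Variables (L : zmodType) (br : L -> L -> L).

Definition biadditive_bracket : Prop :=
  (forall x y z, br (x + y) z = br x z + br y z) /\
  (forall x y z, br x (y + z) = br x y + br x z).

Definition leibniz_ring : Prop :=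
  biadditive_bracket /\
  (forall a b c, br a (br b c) = br (br a b) c + br b (br a c)).

Definition lie_ring : Prop :=
  [/\ biadditive_bracket,
      forall a, br a a = 0
    & forall a b c, br (br a b) c + br (br b c) a + br (br c a) b = 0].

End Brackets.

(* The additive group of a finZmodType is canonically a finGroupType, with    *)
(* group law + and unit 0. Below, <<A>> is thus the additive subgroup         *)
(* generated by A, <[x]> the additive cyclic subgroup generated by x, and     *)
(* \x the internal direct sum of additive subgroups.                          *)
Section FiniteBrackets.

Variables (L : finZmodType) (br : L -> L -> L).

Definition leibniz_kernel : {set L} := <<[set br x x | x : L]>>%g.

Definition derived_ideal : {set L} := <<[set br x y | x : L, y : L]>>%g.

Definition left_center : {set L} := [set x | [forall y, br x y == 0]].

Definition right_center : {set L} := [set x | [forall y, br y x == 0]].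

Definition leib_center : {set L} :=
  [set x | [forall y, (br x y == 0) && (br y x == 0)]].

Definition leibniz_type1 (p : nat) : Prop :=
  exists a b : L,
    [/\ (<[a]> \x <[b]>)%g = [set: L],
        a *+ p = 0 /\ b *+ p = 0,
        [/\ br a a = b, br b a = 0, br a b = 0 & br b b = 0]
      & [/\ leibniz_kernel = <[b]>%g,
            derived_ideal = <[b]>%g
          & leib_center = <[b]>%g]].

(* DEVIATION: the source states that the right center here is 0, which        *)
(* contradicts its own multiplication table: br c (c - d) = d - d = 0 and     *)
(* br d (c - d) = 0, so the right center is <[c - d]>, of order p. The center *)
(* is 0, as stated in the source.                                             *)
Definition leibniz_type2 (p : nat) : Prop :=
  exists c d : L,
    [/\ (<[c]> \x <[d]>)%g = [set: L],
        c *+ p = 0 /\ d *+ p = 0,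
        [/\ br c c = d, br c d = d, br d c = 0 & br d d = 0]
      & [/\ leibniz_kernel = <[d]>%g,
            derived_ideal = <[d]>%g,
            left_center = <[d]>%g,
            right_center = <[c - d]>%g
          & leib_center = <[0 : L]>%g]].

End FiniteBrackets.

(* Main.v *)
Require Import Defs.
From HB Require Import structures.
From mathcomp Require Import all_boot all_order all_algebra.
From mathcomp Require Import all_fingroup all_solvable.

Set Implicit Arguments.
Unset Strict Implicit.
Unset Printing Implicit Defensive.

Import GRing.Theory.
Local Open Scope ring_scope.

(** If [L] is not a Lie ring, then [a, a] = b is nonzero for some [a], because
  an alternating Leibniz bracket satisfies the Jacobi identity.  The Leibniz
  identity gives [b, L] = 0, so [b] is not a multiple of [a] and
  L = <a> (+) <b>.  Since [[a, b], a] = [a, [b, a]] - [b, [a, a]] = 0, the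
  element [a, b] has no component on [a], that is, [a, b] = t b.  If t = 0 this
  is type (1); otherwise c = t^-1 a and d = t^-2 b give type (2). *)

Section Biadditive.

Variables (L : zmodType) (br : L -> L -> L).
Hypothesis br_biadd : biadditive_bracket br.

Lemma brDl x y z : br (x + y) z = br x z + br y z.
Proof. exact: br_biadd.1. Qed.

Lemma brDr x y z : br x (y + z) = br x y + br x z.
Proof. exact: br_biadd.2. Qed.

Lemma br0l y : br 0 y = 0.
Proof. by apply: (addrI (br 0 y)); rewrite -brDl !addr0. Qed.

Lemma br0r x : br x 0 = 0.
Proof. by apply: (addrI (br x 0)); rewrite -brDr !addr0. Qed.

Lemma brMnl x y n : br (x *+ n) y = br x y *+ n.
Proof. by elim: n => [|n IHn]; rewrite ?br0l // !mulrS brDl IHn. Qed.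

Lemma brMnr x y n : br x (y *+ n) = br x y *+ n.
Proof. by elim: n => [|n IHn]; rewrite ?br0r // !mulrS brDr IHn. Qed.

Lemma brNr x y : br x (- y) = - br x y.
Proof. by apply: (addrI (br x y)); rewrite -brDr !subrr br0r. Qed.

Lemma alternating_anticomm :
  (forall x, br x x = 0) -> forall x y, br x y = - br y x.
Proof.
move=> alt x y; apply/eqP; rewrite -addr_eq0; apply/eqP.
by have := alt (x + y); rewrite brDl !brDr !alt add0r addr0.
Qed.

End Biadditive.

(** Anticommutativity turns the Jacobi sum into [[a, b], c] - [a, [b, c]] + [b, [a, c]], which is
    zero by the Leibniz identity. *)
Lemma alternating_leibniz_lie (L : zmodType) (br : L -> L -> L) :
  leibniz_ring br -> (forall x, br x x = 0) -> lie_ring br.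
Proof.
move=> [biadd leib] alt; split=> // a b c.
have anti := alternating_anticomm biadd alt.
rewrite (anti (br b c) a) (anti (br c a) b) (anti c a) (brNr biadd) opprK leib.
by rewrite opprD addrA subrr add0r addNr.
Qed.

(** In the Leibniz identity for a, a, y the term [a, [a, y]] occurs on both sides and cancels. *)
Lemma br_square_left0 (L : zmodType) (br : L -> L -> L) :
  leibniz_ring br -> forall a y, br (br a a) y = 0.
Proof.
move=> [_ leib] a y; apply: (addIr (br a (br a y))).
by rewrite -leib add0r.
Qed.

Section ElementaryAbelian.

Variables (p : nat) (L : finZmodType).
Hypotheses (p_prime : prime p) (L_abelem : (p.-abelem [set: L])%g).

Lemma abelem_mulrn0 (x : L) : x *+ p = 0.
Proof.
have [_ expL] := abelemP p_prime L_abelem.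
by have := expL x (in_setT x); rewrite FinRing.zmodXgE.
Qed.

Lemma abelem_order (x : L) : x != 0 -> #[x]%g = p.
Proof. by move=> x0; apply: (abelem_order_p L_abelem (in_setT x)). Qed.

Lemma abelem_mulrn_eq0 (x : L) n : x != 0 -> (x *+ n == 0) = (p %| n)%N.
Proof. by move=> x0; rewrite -(abelem_order x0) order_dvdn FinRing.zmodXgE. Qed.

Lemma cycle_mulrnP (x y : L) :
  reflect (exists i, y = x *+ i) (y \in <[x]>%g).
Proof.
by apply: (iffP (cycleP x y)) => -[i ->]; exists i; rewrite FinRing.zmodXgE.
Qed.

(** [<[f]>] has prime order, hence meets [<[e]>] trivially, and the sum of the two then has p^2
    elements. *)
Lemma abelem2_dprod (e f : L) : #|[set: L]| = (p ^ 2)%N ->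
  e != 0 -> f \notin <[e]>%g -> (<[e]> \x <[f]>)%g = [set: L].
Proof.
move=> cardL e0 fe.
have f0 : f != 0 by apply: contraNneq fe => ->; apply: group1.
have tiEF : (<[e]> :&: <[f]> = 1)%g.
  rewrite setIC; apply: prime_TIg; last by rewrite cycle_subG.
  by rewrite -/(#[f]%g) abelem_order.
have cEF : (<[f]> \subset 'C(<[e]>))%g.
  by apply: sub_abelian_cent2 (abelem_abelian L_abelem) _ _; apply: subsetT.
rewrite dprodE //; apply/eqP; rewrite eqEcard subsetT cardL TI_cardMg //.
by rewrite -/(#[e]%g) -/(#[f]%g) !abelem_order // mulnn leqnn.
Qed.

Lemma dprod_cycleP (e f x : L) : (<[e]> \x <[f]>)%g = [set: L] ->
  exists i j, x = e *+ i + f *+ j.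
Proof.
move=> defL; have [y [z [ye zf -> _]]] := mem_dprod defL (in_setT x).
have [i ->] := cycle_mulrnP _ _ ye; have [j ->] := cycle_mulrnP _ _ zf.
by exists i, j; rewrite FinRing.zmodMgE.
Qed.

Variables (br : L -> L -> L) (e f : L) (t : nat).
Hypotheses (br_biadd : biadditive_bracket br) (f0 : f != 0).

(** If f = m e, then 0 = [f, e] = m f, so p divides m and f = m e = 0. *)
Lemma square_notin_cycle : br e e = f -> br f e = 0 -> f \notin <[e]>%g.
Proof.
move=> ee fe; apply/negP=> /cycle_mulrnP[m fE].
have e0 : e != 0 by apply: contraNneq f0 => e0; rewrite fE e0 mul0rn.
have := fe; rewrite {1}fE (brMnl br_biadd) ee => /eqP.
rewrite abelem_mulrn_eq0 // -(abelem_mulrn_eq0 _ e0) -fE.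
exact/negP.
Qed.

Hypothesis defL : (<[e]> \x <[f]>)%g = [set: L].
Hypotheses (ee : br e e = f) (ef : br e f = f *+ t).
Hypotheses (fe : br f e = 0) (ff : br f f = 0).

(** This multiplication table treats both types at once: [t = 0] is type (1) and [t = 1] is type
    (2). *)
Lemma br_coord i j k l :
  br (e *+ i + f *+ j) (e *+ k + f *+ l) = f *+ (i * (k + t * l)).
Proof.
rewrite (brDl br_biadd) !(brDr br_biadd) !(brMnl br_biadd) !(brMnr br_biadd).
rewrite ee ef fe ff !mul0rn !addr0 -!mulrnA -mulrnDr mulnDr.
by rewrite [(k * i)%N]mulnC mulnA [(t * l * i)%N]mulnC.
Qed.

Lemma br_in_cycle x y : br x y \in <[f]>%g.
Proof.
have [i [j ->]] := dprod_cycleP x defL; have [k [l ->]] := dprod_cycleP y defL.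
by rewrite br_coord; apply/cycle_mulrnP; eexists.
Qed.

(** All brackets are multiples of f, and f = [e, e] is itself a square; the same two facts settle
    the derived ideal. *)
Lemma leibniz_kernel_cycle : leibniz_kernel br = <[f]>%g.
Proof.
apply/eqP; rewrite eqEsubset gen_subG cycle_subG -{2}ee mem_gen ?imset_f //.
by rewrite andbT; apply/subsetP=> _ /imsetP[x _ ->]; apply: br_in_cycle.
Qed.

Lemma derived_ideal_cycle : derived_ideal br = <[f]>%g.
Proof.
apply/eqP; rewrite eqEsubset gen_subG cycle_subG -{2}ee mem_gen ?imset2_f //.
by rewrite andbT; apply/subsetP=> _ /imset2P[x y _ _ ->]; apply: br_in_cycle.
Qed.

Lemma left_center_cycle : left_center br = <[f]>%g.
Proof.
apply/setP=> x; rewrite inE; apply/forallP/cycle_mulrnP => [zx | [j ->] y].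
  have [i [j xE]] := dprod_cycleP x defL; exists j.
  (* Testing against e suffices: [i e + j f, e] = i f vanishes only if p divides i. *)
  have := zx e; have := br_coord i j 1 0.
  rewrite -xE mulr1n mulr0n addr0 muln0 addn0 muln1 => ->.
  rewrite abelem_mulrn_eq0 // => /dvdnP[m iE].
  by rewrite xE iE mulnC mulrnA abelem_mulrn0 mul0rn add0r.
have [k [l ->]] := dprod_cycleP y defL.
by have := br_coord 0 j k l; rewrite mulr0n add0r mul0n => ->.
Qed.

Lemma br_e_coord k l : br e (e *+ k + f *+ l) = f *+ (k + t * l).
Proof. by have := br_coord 1 0 k l; rewrite mulr0n mulr1n addr0 mul1n. Qed.

Lemma leib_centerE : leib_center br = left_center br :&: right_center br.
Proof.
apply/setP=> x; rewrite !inE.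
apply/forallP/andP=> [zx | [/forallP zl /forallP zr] y]; last by rewrite zl zr.
by split; apply/forallP=> y; have /andP[] := zx y.
Qed.

(** Since [i e + j f, y] = i [e, y], only the bracket [e, y] = (k + t l) f matters. *)
Lemma right_center_mem k l :
  (e *+ k + f *+ l \in right_center br) = (p %| k + t * l)%N.
Proof.
rewrite inE; apply/forallP/idP => [zy | dv y].
  by rewrite -(abelem_mulrn_eq0 _ f0) -br_e_coord.
have [i [j ->]] := dprod_cycleP y defL.
by rewrite br_coord abelem_mulrn_eq0 // dvdn_mull.
Qed.

Lemma leib_center_type1 : t = 0%N -> leib_center br = <[f]>%g.
Proof.
move=> t0; rewrite leib_centerE left_center_cycle; apply/setIidPl/subsetP=> y.
case/cycle_mulrnP=> l ->; have := right_center_mem 0 l.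
by rewrite t0 mulr0n add0r dvdn0.
Qed.

(** The condition is now that p divides k + l, so that l f = - k f and k e + l f = k (e - f). *)
Lemma right_center_type2 : t = 1%N -> right_center br = <[e - f]>%g.
Proof.
move=> t1; apply/setP=> y; apply/idP/cycle_mulrnP=> [|[i ->]].
  have [k [l ->]] := dprod_cycleP y defL.
  rewrite right_center_mem t1 mul1n => dv; exists k; rewrite mulrnBl.
  congr (_ + _); apply/eqP.
  by rewrite -addr_eq0 -mulrnDr addnC abelem_mulrn_eq0.
rewrite inE; apply/forallP=> x; have [j [k ->]] := dprod_cycleP x defL.
rewrite (brMnr br_biadd) (brDr br_biadd) (brNr br_biadd).
have := br_coord j k 1 0; have := br_coord j k 0 1.
rewrite !mulr0n !mulr1n add0r addr0 t1 => -> ->.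
by rewrite subrr mul0rn.
Qed.

Lemma leib_center_type2 : t = 1%N -> leib_center br = <[0 : L]>%g.
Proof.
move=> t1; rewrite leib_centerE left_center_cycle.
apply/setP=> y; rewrite !inE cycle1 inE; apply/andP/eqP=> [[]|->].
  (* An element l f of the left center satisfies [e, l f] = l f, so it is right central only if it
     is zero. *)
  case/cycle_mulrnP=> l -> /forallP/(_ e).
  by rewrite (brMnr br_biadd) ef t1 mulr1n => /eqP.
split; first exact: group1.
by apply/forallP=> x; rewrite br0r.
Qed.

End ElementaryAbelian.

Lemma prime_mul_inv p t : prime p -> ~~ (p %| t)%N ->
  exists u m, (u * t = 1 + m * p)%N.
Proof.
move=> p_pr pt.
have t0 : (0 < t)%N by case: t pt => //; rewrite dvdn0.
have : coprime t p by rewrite coprime_sym prime_coprime.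
case/(coprimeP _ t0)=> -[u m] /= E; exists u, m.
(* [E] uses truncated subtraction; as the difference is 1, no truncation occurs. *)
by rewrite -E subnK // ltnW // -subn_gt0 E.
Qed.

Theorem mainTheorem2 (p : nat) (L : finZmodType) (br : L -> L -> L)
    (p_prime : prime p)
    (L_leibniz : leibniz_ring br)
    (L_abelem : (p.-abelem [set: L])%g)
    (L_order : #|[set: L]| = (p ^ 2)%N)
    (L_not_lie : ~ lie_ring br) :
  leibniz_type1 br p \/ leibniz_type2 br p.
Proof.
have [biadd leib] := L_leibniz.
have [a aa0 | alt] := pickP (fun x => br x x != 0); last first.
  case: L_not_lie; apply: alternating_leibniz_lie => // x.
  by apply/eqP; have /negbFE := alt x.
pose b := br a a; have b0 : b != 0 by [].
have bL y : br b y = 0 by apply: br_square_left0.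
have a0 : a != 0 by apply: contraNneq aa0 => ->; rewrite br0r.
have ba : b \notin <[a]>%g.
  exact: (square_notin_cycle L_abelem biadd b0 erefl (bL a)).
have defL := abelem2_dprod p_prime L_abelem L_order a0 ba.
have [s [t abE]] := dprod_cycleP (br a b) defL.
have ab : br a b = b *+ t.
  have : br (br a b) a = 0.
    by have := leib a b a; rewrite !bL br0r // addr0.
  (* For [a, b] = s a + t b, bracketing with a leaves s b = 0; hence p divides s and s a = 0. *)
  rewrite abE (brDl biadd) !(brMnl biadd) bL mul0rn addr0 -/b => /eqP.
  rewrite (abelem_mulrn_eq0 L_abelem _ b0) -(abelem_mulrn_eq0 L_abelem _ a0).
  by move=> /eqP ->; rewrite add0r.
have torsion := abelem_mulrn0 p_prime L_abelem.
have [pt | pt] := boolP (p %| t)%N.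
  have ab0 : br a b = 0.
    by rewrite ab; apply/eqP; rewrite (abelem_mulrn_eq0 L_abelem).
  left; exists a, b; split=> //; split.
  - exact: leibniz_kernel_cycle biadd defL erefl ab (bL a) (bL b).
  - exact: derived_ideal_cycle biadd defL erefl ab (bL a) (bL b).
  - exact: (leib_center_type1 p_prime L_abelem biadd b0 defL erefl
             (t := 0) ab0 (bL a) (bL b)).
have [u [m uE]] := prime_mul_inv p_prime pt.
(* The natural number u represents the inverse of t modulo p. *)
pose c := a *+ u; pose d := b *+ (u * u).
have pu : ~~ (p %| u)%N.
  apply/negP=> pu; have : (p %| u * t)%N by rewrite dvdn_mulr.
  by rewrite uE dvdn_addl ?dvdn_mull // dvdn1 => /eqP p1; rewrite p1 in p_prime.
have d0 : d != 0.
  by rewrite (abelem_mulrn_eq0 L_abelem) // Euclid_dvdM // orbb.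
have c0 : c != 0 by rewrite (abelem_mulrn_eq0 L_abelem).
have dL y : br d y = 0 by rewrite (brMnl biadd) bL mul0rn.
have cc : br c c = d by rewrite (brMnl biadd) (brMnr biadd) -mulrnA.
(* [c, d] = u^3 t b = u^2 (1 + m p) b = d; the form [d *+ 1] matches the common table at [t = 1]. *)
have cd : br c d = d *+ 1.
  rewrite (brMnl biadd) (brMnr biadd) ab -!mulrnA mulnC -mulnA uE.
  by rewrite mulrnA -/d mulrnDr mulrnA torsion addr0 muln1.
have dc : d \notin <[c]>%g.
  exact: (square_notin_cycle L_abelem biadd d0 cc (dL c)).
have defL' := abelem2_dprod p_prime L_abelem L_order c0 dc.
right; exists c, d; split=> //; split.
- exact: leibniz_kernel_cycle biadd defL' cc cd (dL c) (dL d).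
- exact: derived_ideal_cycle biadd defL' cc cd (dL c) (dL d).
- exact: (left_center_cycle p_prime L_abelem biadd d0 defL' cc cd (dL c) (dL d)).
- exact: (right_center_type2 L_abelem biadd d0 defL' cc cd (dL c)
           (dL d) erefl).
- exact: (leib_center_type2 p_prime L_abelem biadd d0 defL' cc cd (dL c)
           (dL d) erefl).
Qed.
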